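(* For every positive integer $k$, there exists an extremal Type~II $\mathbb{Z}_{2k}$-code of length $32$, and there exists an extremal Type~II $\mathbb{Z}_{2k}$-code of length $40$.
   Context: $\mathbb{Z}_m$ denotes the ring of integers modulo $m$. A $\mathbb{Z}_m$-code of length $n$ is a $\mathbb{Z}_m$-submodule of $\mathbb{Z}_m^n$; it is self-dual if $C=C^\perp$, where $C^\perp=\{x\in\mathbb{Z}_m^n : x\cdot y=0 \text{ for all } y\in C\}$ with respect to the standard inner product. The Euclidean weight of $x=(x_1,\dots,x_n)\in\mathbb{Z}_m^n$ is $\sum_{\alpha=1}^{\lfloor m/2\rfloor} n_\alpha(x)\alpha^2$, where $n_\alpha(x)$ is the number of $i$ with $x_i\equiv\pm\alpha \pmod m$; $d_E(C)$ is the minimum Euclidean weight of a nonzero codeword of $C$. A Type~II $\mathbb{Z}_{2k}$-code is a self-dual $\mathbb{Z}_{2k}$-code all of whose codewords have Euclidean weight divisible by $4k$. For a Type~II $\mathbb{Z}_{2k}$-code $C$ of length $n\le 136$ one has $d_E(C)\le 4k\lfloor n/24\rfloor+4k$, and $C$ is called extremal if equality holds. *)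

(* Defs.v *)
From HB Require Import structures.
From mathcomp Require Import all_boot all_order all_algebra.
Set Implicit Arguments. Unset Strict Implicit. Unset Printing Implicit Defensive.
Import GRing.Theory.
Local Open Scope ring_scope.

Section Codes.
Variables m n : nat.
Local Notation word := 'rV['Z_m]_n.

Definition is_code (C : {set word}) : Prop :=
  [/\ 0 \in C,
      (forall x y, x \in C -> y \in C -> x + y \in C) &
      (forall (a : 'Z_m) x, x \in C -> a *: x \in C)].

Definition dotZ (x y : word) : 'Z_m := \sum_(i < n) x 0 i * y 0 i.

Definition dual_code (C : {set word}) : {set word} :=
  [set x | [forall y in C, dotZ x y == 0]].

Definition self_dual (C : {set word}) : Prop := is_code C /\ C = dual_code C.

Definition n_alpha (a : nat) (x : word) : nat :=
  #|[set i : 'I_n | (x 0 i == a%:R) || (x 0 i == - a%:R)]|.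

Definition euclid_weight (x : word) : nat :=
  (\sum_(1 <= a < (m./2).+1) n_alpha a x * a ^ 2)%N.

Definition is_min_euclid_weight (C : {set word}) (d : nat) : Prop :=
  (exists2 x, x \in C & (x != 0) && (euclid_weight x == d)) /\
  (forall x, x \in C -> x != 0 -> (d <= euclid_weight x)%N).
End Codes.

Definition typeII (k n : nat) (C : {set 'rV['Z_(k.*2)]_n}) : Prop :=
  self_dual C /\ (forall x, x \in C -> (4 * k %| euclid_weight x)%N).

Definition extremal_typeII (k n : nat) (C : {set 'rV['Z_(k.*2)]_n}) : Prop :=
  typeII C /\ is_min_euclid_weight C (4 * k * (n %/ 24) + 4 * k)%N.

(* Main.v *)
(* Let L be an even unimodular lattice of rank n with an orthogonal frame f_1, ..., f_n of norm 2k. The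
   vectors (x.f_i mod 2k), for x in L, form a Type II Z_2k-code, and when every x in L of norm less than 4
   is an integral combination of the f_i its minimum Euclidean weight is 8k, provided some x in L of norm 4
   is not such a combination. For n = 32 and n = 40 this is the extremal value.

   For k = 1 take L = Construction A of a double circulant binary code of minimum weight 8.

   For k >= 2 a single lattice L of minimum norm 4 is used in each dimension. It comes from a Z_4-code whose
   residue code C_1 (generated by G mod 2) is doubly even of minimum weight 12, has dual distance 4 and
   contains the all-one word; scaled by 2, L = {u G + 2 w : G w even}. In particular L contains 2 y for
   every integral y with y mod 2 in the dual of C_1. Filling the Cayley-Graves array of the octonions
   with circulant blocks gives a weighing matrix N of weight 6 and four signed permutation matrices
   X_1, ..., X_4 such that N + 2 (b_1 X_1 + ... + b_4 X_4) has orthogonal rows of norm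
   6 + 4 (b_1^2 + ... + b_4^2); C_1 is chosen inside the kernel of N mod 2, so that these rows, doubled,
   lie in L. By the four-square theorem they provide frames of norm 2k for every odd k >= 3, while
   4 (b_1 X_1 + ... + b_4 X_4) does so for every even k. *)
Require Import Defs.
From mathcomp Require Import all_boot all_order all_algebra.
From mathcomp Require Import zify ring lra.
From mathcomp Require Import boolp.
Set Implicit Arguments.
Unset Strict Implicit.
Unset Printing Implicit Defensive.
Import Order.TTheory GRing.Theory Num.Theory.
Local Open Scope ring_scope.

(** * Euclidean weight and integral lifts *)

Section EuclidWeight.
Variable k : nat.
Hypothesis k_gt0 : (0 < k)%N.
Local Notation Z2k := 'Z_(k.*2).

Let m_gt1 : (1 < k.*2)%N. Proof. lia. Qed.

Lemma Z2k_intr_eq0 (z : int) : ((z%:~R : Z2k) == 0) = (k.*2%:Z %| z)%Z.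
Proof.
have nat_eq0 (t : nat) : ((t%:R : Z2k) == 0) = (k.*2 %| t)%N.
  by rewrite -val_eqE /= val_Zp_nat.
by rewrite dvdzE /=; case: z => t; rewrite ?NegzE ?mulrNz ?oppr_eq0 ?abszN -pmulrn nat_eq0.
Qed.

Lemma Z2k_val (a : Z2k) : (a : nat)%:~R = a :> Z2k.
Proof. by rewrite -pmulrn natr_Zp. Qed.

Lemma Z2k_lt (a : Z2k) : (a < k.*2)%N.
Proof. by rewrite -[X in (_ < X)%N](Zp_cast m_gt1) ltn_ord. Qed.

(** As [0 <= a < 2k] and [0 < t <= k], the only multiple of [2k] that [a - t] can be is [0], and the
    only one that [a + t] can be is [2k]. *)
Lemma Z2k_eq_pm (a : Z2k) (t : nat) : (0 < t <= k)%N ->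
  (a == t%:R) || (a == - t%:R) = (minn a (k.*2 - a) == t).
Proof.
move=> ht; have ha := Z2k_lt a.
rewrite -[a in LHS]natr_Zp -subr_eq0 -addr_eq0 !pmulrn -mulrzBr -mulrzDr.
rewrite !Z2k_intr_eq0.
apply/idP/idP.
  case/orP=> /dvdzP[q hq].
  - have q0 : q = 0 by nia.
    by move: hq; rewrite q0 mul0r; lia.
  - have q1 : q = 1 by nia.
    by move: hq; rewrite q1 mul1r; lia.
by move=> /eqP h; apply/orP; case: (leqP a (k.*2 - a)) => h';
  [left; apply/dvdzP; exists 0; lia| right; apply/dvdzP; exists 1; lia].
Qed.

(** After exchanging the sums, a nonzero coordinate [a] is counted for exactly one [alpha], namely
    [minn a (2k - a)], and a zero coordinate for none. *)
Lemma euclid_weightE n (c : 'rV[Z2k]_n) :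
  euclid_weight c = (\sum_i (minn (c ord0 i) (k.*2 - c ord0 i)) ^ 2)%N.
Proof.
rewrite /euclid_weight doubleK.
under eq_bigr => a _ do rewrite /n_alpha -sum1dep_card big_distrl /=.
under eq_big_nat => a ha.
  under eq_bigl => i do rewrite Z2k_eq_pm //.
  rewrite big_mkcond /=.
  over.
rewrite exchange_big /=; apply: eq_bigr => i _.
set w := minn _ _; have hw : (w <= k)%N by have := Z2k_lt (c ord0 i); lia.
case: (posnP w) => [->|w0].
  by rewrite big_nat big1 // => a ha; case: eqP => //; lia.
rewrite (bigD1_seq w) ?iota_uniq ?mem_index_iota //= ?eqxx ?mul1n; last by lia.
by rewrite big1 ?addn0 // => a; rewrite eq_sym => /negPf ->.
Qed.

(** The representatives in [(-k, k]] attain the Euclidean weight; together with [euclid_weight_le]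
    this makes it the least norm of an integral lift. *)
Lemma euclid_weight_lift n (c : 'rV[Z2k]_n) : exists z : 'rV[int]_n,
  map_mx intr z = c /\ (euclid_weight c)%:Z = \sum_i z 0 i ^+ 2.
Proof.
exists (\row_i (if (c ord0 i <= k)%N then (c ord0 i : nat)%:Z else (c ord0 i : nat)%:Z - k.*2%:Z)).
split.
  apply/rowP=> i; rewrite !mxE; case: ifP => _; first exact: Z2k_val.
  rewrite mulrzBr Z2k_val; apply/eqP; rewrite subr_eq addrC -subr_eq subrr eq_sym.
  by rewrite Z2k_intr_eq0.
rewrite euclid_weightE (big_morph Posz PoszD (erefl 0%:Z)); apply: eq_bigr => i _.
rewrite mxE -mulnn PoszM expr2.
have ha := Z2k_lt (c 0 i); set a := nat_of_ord _ in ha *.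
by case: ifP => h; [rewrite (minn_idPl _)|rewrite (minn_idPr _)]; nia.
Qed.

Lemma euclid_weight_le n (z : 'rV[int]_n) :
  (euclid_weight (map_mx intr z : 'rV[Z2k]_n))%:Z <= \sum_i z 0 i ^+ 2.
Proof.
rewrite euclid_weightE (big_morph Posz PoszD (erefl 0%:Z)); apply: ler_sum => i _.
rewrite mxE -mulnn PoszM expr2.
set a : Z2k := (z 0 i)%:~R; have ha := Z2k_lt a.
have /dvdzP[q hq] : (k.*2%:Z %| z ord0 i - (a : nat)%:Z)%Z.
  by rewrite -Z2k_intr_eq0 mulrzBr Z2k_val subrr.
have -> : z ord0 i = q * k.*2%:Z + (a : nat)%:Z by lia.
set w : int := Posz (minn _ _); set x := q * _ + _.
have w0 : 0 <= w by [].
have : w <= x \/ x <= - w.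
  rewrite /w /x; case: (ltrP q 0) => q0.
    by right; have : q * k.*2%:Z <= - k.*2%:Z by [nia]; lia.
  by left; have : 0 <= q * k.*2%:Z by [nia]; lia.
by nia.
Qed.

End EuclidWeight.

(** * Codes from orthogonal frames *)

Section Dot.
Variable n : nat.
Implicit Types x y z : 'rV[int]_n.

Definition dot x y : int := (x *m y^T) 0 0.

Lemma dotE x y : dot x y = \sum_i x 0 i * y 0 i.
Proof. by rewrite /dot mxE; apply: eq_bigr => i _; rewrite mxE. Qed.

Lemma dotC x y : dot x y = dot y x.
Proof. by rewrite !dotE; apply: eq_bigr => i _; rewrite mulrC. Qed.

Lemma dotDl x y z : dot (x + y) z = dot x z + dot y z.
Proof. by rewrite /dot mulmxDl mxE. Qed.

Lemma dotZl a x y : dot (a *: x) y = a * dot x y.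
Proof. by rewrite /dot -scalemxAl mxE. Qed.

Lemma dotDr x y z : dot x (y + z) = dot x y + dot x z.
Proof. by rewrite dotC dotDl !(dotC _ x). Qed.

Lemma dotZr a x y : dot x (a *: y) = a * dot x y.
Proof. by rewrite dotC dotZl dotC. Qed.

Lemma dot_delta x i : dot x (delta_mx 0 i) = x 0 i.
Proof. by rewrite /dot trmx_delta -colE mxE. Qed.

Lemma dot_ge0 x : 0 <= dot x x.
Proof. by rewrite dotE; apply: sumr_ge0 => i _; rewrite -expr2 sqr_ge0. Qed.

Lemma dot_self x : dot x x = \sum_i x 0 i ^+ 2.
Proof. by rewrite dotE; apply: eq_bigr => i _; rewrite expr2. Qed.

End Dot.

Lemma dot_mulmx m n (A : 'M[int]_(m, n)) x y : dot (x *m A) y = dot x (y *m A^T).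
Proof. by rewrite /dot trmx_mul trmxK mulmxA. Qed.

Lemma dot_row m n (A : 'M[int]_(m, n)) x i : dot (row i A) x = (x *m A^T) 0 i.
Proof. by rewrite rowE dot_mulmx dotC dot_delta. Qed.

(** Over the rationals [A^T / c] is a one-sided inverse of a square matrix, hence two-sided. *)
Lemma mulmx_tr_scalarC n (A : 'M[int]_n) c : c != 0 ->
  A *m A^T = c%:M -> A^T *m A = c%:M.
Proof.
move=> c0 h; pose f := map_mx (intr : int -> rat).
have inj : injective (f n n).
  by move=> X Y /matrixP e; apply/matrixP=> i j; have := e i j; rewrite !mxE => /intr_inj.
have cc0 : c%:~R != 0 :> rat by rewrite intr_eq0.
apply: inj; rewrite /f map_mxM map_scalar_mx /=.
have : (c%:~R^-1 *: map_mx intr A) *m map_mx intr A^T = 1%:M :> 'M[rat]_n.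
  by rewrite -scalemxAl -map_mxM h map_scalar_mx /= scale_scalar_mx mulVf.
move/mulmx1C; rewrite -scalemxAr => e.
by rewrite -[LHS](scalerK cc0) scalerA mulrC -scalerA e scale_scalar_mx mulr1.
Qed.

(* [L] is an even unimodular lattice in coordinates where its form is [dot / s], [F] an orthogonal frame of
   norm [2k] in it; the code is the set of coordinate vectors modulo [2k] of [L]
   with respect to [F]: [x = z *m F / 2k]. *)
Lemma extremal_of_frame (n k : nat) (s : int) (L : 'rV[int]_n -> Prop)
    (F : 'M[int]_n) :
  (0 < k)%N -> 0 < s ->
  (forall x, L x <-> forall y, L y -> (s %| dot x y)%Z) ->
  (forall x, L x -> (2 * s %| dot x x)%Z) ->
  (forall i, L (row i F)) ->
  F *m F^T = (2 * k%:Z * s)%:M ->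
  (forall x, L x -> dot x x < 4 * s -> exists u, x = u *m F) ->
  (exists x, [/\ L x, dot x x = 4 * s & ~ exists u, x = u *m F]) ->
  exists C : {set 'rV['Z_(k.*2)]_n}, typeII C /\ is_min_euclid_weight C (8 * k).
Proof.
move=> k0 s0 Ldual Leven LF FF Lmin [x0 [Lx0 Nx0 Fx0]].
have L0 : L 0 by apply/Ldual => y _; rewrite dotE big1 ?dvdz0 // => i _; rewrite mxE mul0r.
have LD x y : L x -> L y -> L (x + y).
  by move=> /Ldual Lx /Ldual Ly; apply/Ldual => z Lz; rewrite dotDl rpredD ?Lx ?Ly.
have LZ : forall (a : int) x, L x -> L (a *: x).
  by move=> a x /Ldual Lx; apply/Ldual => z Lz; rewrite dotZl dvdz_mull ?Lx.
have LuF u : L (u *m F).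
  rewrite mulmx_sum_row; apply: (big_ind L) => // i _; exact: LZ.
have Ls i : L (s *: delta_mx 0 i).
  by apply/Ldual => y _; rewrite dotZl dvdz_mulr.
set c : int := 2 * k%:Z * s in FF.
have c0 : c != 0 by rewrite /c; lia.
have FtF : F^T *m F = c%:M by apply: mulmx_tr_scalarC FF.
have dotF u v : dot (u *m F) (v *m F) = c * dot u v.
  by rewrite dot_mulmx -mulmxA FF mul_mx_scalar dotZr.
have Finj u v : u *m F = v *m F -> u = v.
  move=> e; apply/(@scalemx_inj _ _ _ c) => //.
  by rewrite -!mul_mx_scalar -FF !mulmxA e.
pose t : int := 2 * k%:Z.
have t0 : t != 0 by rewrite /t; lia.
pose rel z x := L x /\ z *m F = t *: x.
pose C := [set w : 'rV['Z_(k.*2)]_n | `[< exists z x, map_mx intr z = w /\ rel z x >]].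
have CP w : reflect (exists z x, map_mx intr z = w /\ rel z x) (w \in C).
  by rewrite inE; apply: asboolP.
have mapE (z z' : 'rV[int]_n) : map_mx intr z = map_mx intr z' :> 'rV['Z_(k.*2)]_n ->
    exists v, z' = z + t *: v.
  move/rowP=> e; exists (\row_i divz (z' 0 i - z 0 i) t).
  apply/rowP=> i; rewrite !mxE [t * _]mulrC divzK; first by rewrite addrC subrK.
  have -> : t = k.*2%:Z by rewrite /t; lia.
  rewrite -Z2k_intr_eq0 // mulrzBr subr_eq0; apply/eqP.
  by have := e i; rewrite !mxE.
have liftC z : map_mx intr z \in C -> exists x, rel z x.
  case/CP=> z' [x [/mapE[v ->] [Lx zx]]]; exists (x + v *m F); split; first exact: LD.
  by rewrite mulmxDl zx -scalemxAl scalerDr.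
(* The quotients [x.f_i / s] are integers because [L] is self-dual, and [FtF] makes them the
   coordinates of [2k x] in the frame. *)
have rel_of x : L x -> exists z, rel z x.
  move=> Lx; exists (\row_i divz ((x *m F^T) 0 i) s); split=> //.
  apply: (@scalemx_inj _ _ _ s); first by rewrite gt_eqF.
  rewrite scalemxAl; set y := _ *: _.
  have -> : y = x *m F^T.
    apply/rowP=> i; rewrite !mxE mulrC divzK //.
    by have := (Ldual x).1 Lx _ (LF i); rewrite dotC dot_row mxE.
  by rewrite -mulmxA FtF mul_mx_scalar scalerA /c mulrC.
(* Passing to coordinates multiplies the form [dot / s] by [2k]: lattice norms 2 and 4 become [4k]
   and [8k]. *)
have dot_rel z z' x x' : rel z x -> rel z' x' -> s * dot z z' = t * dot x x'.
  move=> [_ zx] [_ zx']; have := dotF z z'; rewrite zx zx' dotZl dotZr.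
  by rewrite /c -/t => e; apply: (mulfI t0); rewrite mulrA -e.
have dotZE (z z' : 'rV[int]_n) :
    dotZ (map_mx intr z) (map_mx intr z') = (dot z z')%:~R :> 'Z_(k.*2).
  rewrite /dotZ dotE rmorph_sum; apply: eq_bigr => i _.
  by rewrite !mxE rmorphM.
have t_eq : t = k.*2%:Z by rewrite /t; lia.
have map0 z : (map_mx intr z == 0 :> 'rV['Z_(k.*2)]_n) -> exists u, z = t *: u.
  move/eqP; rewrite -[X in _ = X](map_mx0 (intr : int -> 'Z_(k.*2))) => /esym /mapE[v ->].
  by exists v; rewrite add0r.
(* A shortest lift of a word of weight below [8k] comes from some [x] of norm below 4. Then [x] lies
   in the span of the frame, so the lift is divisible by [2k]. *)
have C_ge w : w \in C -> w != 0 -> (8 * k <= euclid_weight w)%N.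
  move=> wC; apply: contraR; rewrite -ltnNge => lt8.
  have [z [zw wt]] := euclid_weight_lift k0 w.
  have [x rx] : exists x, rel z x by apply: liftC; rewrite zw.
  have := dot_rel _ _ _ _ rx rx; rewrite dot_self -wt => e.
  have [u xu] : exists u, x = u *m F.
    by apply: Lmin; [exact: rx.1|rewrite /t in e; nia].
  have zu : z = t *: u by apply: Finj; rewrite rx.2 xu scalemxAl.
  apply/eqP/rowP=> i; rewrite -zw zu !mxE; apply/eqP.
  by rewrite Z2k_intr_eq0 // -t_eq dvdz_mulr.
exists C; split; last split.
- split.
    split.
      split.
      + by apply/CP; exists 0, 0; split; [rewrite map_mx0|split=> //; rewrite mul0mx scaler0].
      + move=> _ _ /CP[z [x [<- [Lx zx]]]] /CP[z' [x' [<- [Lx' zx']]]].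
        apply/CP; exists (z + z'), (x + x'); split; first by rewrite map_mxD.
        by split; [exact: LD|rewrite mulmxDl zx zx' scalerDr].
      + move=> a _ /CP[z [x [<- [Lx zx]]]]; apply/CP.
        exists ((a : nat)%:Z *: z), ((a : nat)%:Z *: x); split.
          by rewrite map_mxZ -[in RHS](Z2k_val a).
        by split; [exact: LZ|rewrite -scalemxAl zx !scalerA mulrC].
    apply/setP=> w; rewrite [in RHS]inE; apply/idP/forall_inP.
      case/CP=> z [x [<- zx]] _ /CP[z' [x' [<- zx']]].
      rewrite dotZE Z2k_intr_eq0 // -t_eq.
      have /dvdzP[q hq] := (Ldual x).1 zx.1 _ zx'.1.
      have := dot_rel _ _ _ _ zx zx'; rewrite hq => e.
      apply/dvdzP; exists q; apply: (@mulfI _ s); first by rewrite gt_eqF.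
      by rewrite e; ring.
    (* Orthogonality to [C] makes [z *m F] pair with [L] into multiples of [t * s]. Testing on the
       vectors [s *: delta_mx 0 i] of [L] shows that [z *m F] is divisible by [t], and the quotient
       lies in the dual of [L], which is [L]. *)
    move=> orth; have [z [zw _]] := euclid_weight_lift k0 w.
    have key y : L y -> (t * s %| dot (z *m F) y)%Z.
      move=> Ly; have [z' rz'] := rel_of y Ly.
      have /orth : map_mx intr z' \in C by apply/CP; exists z', y.
      rewrite -zw dotZE Z2k_intr_eq0 // -t_eq => /dvdzP[q hq].
      apply/dvdzP; exists q; apply: (mulfI t0).
      by rewrite -dotZr -rz'.2 dotF hq /c -/t; ring.
    have [x zx] : exists x, z *m F = t *: x.
      exists (\row_i divz ((z *m F) 0 i) t).
      apply/rowP=> i; rewrite [RHS]mxE [in RHS]mxE mulrC divzK //.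
      have := key _ (Ls i); rewrite dotZr dot_delta [t * s]mulrC.
      by rewrite dvdz_mul2l // gt_eqF.
    apply/CP; exists z, x; split=> //; split=> //; apply/Ldual => y /key.
    by rewrite zx dotZl dvdz_mul2l.
  move=> w wC; have [z [zw wt]] := euclid_weight_lift k0 w.
  have [x rx] : exists x, rel z x by apply: liftC; rewrite zw.
  have := dot_rel _ _ _ _ rx rx; have /dvdzP[q ->] := Leven _ rx.1.
  rewrite dot_self -wt => e.
  have {}e : (euclid_weight w)%:Z = q * (4 * k)%N%:Z.
    apply: (@mulfI _ s); first by rewrite gt_eqF.
    by rewrite e /t PoszM; ring.
  by have : ((4 * k)%N %| Posz (euclid_weight w))%Z by rewrite e dvdz_mull.
- have [z rz] := rel_of _ Lx0.
  have wC : map_mx intr z \in C by apply/CP; exists z, x0.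
  have w0 : map_mx intr z != 0 :> 'rV['Z_(k.*2)]_n.
    apply/negP=> /map0[u zu]; apply: Fx0; exists u.
    apply: (@scalemx_inj _ _ _ t) => //.
    by rewrite -rz.2 zu scalemxAl.
  exists (map_mx intr z) => //; rewrite w0 /= eqn_leq C_ge // andbT.
  have := euclid_weight_le k0 z; rewrite -dot_self.
  have := dot_rel _ _ _ _ rz rz; rewrite Nx0 => e.
  have -> : dot z z = (8 * k)%N%:Z.
    apply: (@mulfI _ s); first by rewrite gt_eqF.
    by rewrite e /t PoszM; ring.
  by [].
exact: C_ge.
Qed.

(** * The four-square theorem *)

Definition sum4sq (z : int) : Prop :=
  exists a b c d : int, z = a ^+ 2 + b ^+ 2 + c ^+ 2 + d ^+ 2.

(** Euler's identity: the quaternion norm is multiplicative. *)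
Lemma sum4sqM y z : sum4sq y -> sum4sq z -> sum4sq (y * z).
Proof.
move=> [a [b [c [d ->]]]] [e [f [g [h ->]]]].
exists (a * e + b * f + c * g + d * h), (a * f - b * e + c * h - d * g),
  (a * g - c * e + d * f - b * h), (a * h - d * e + b * g - c * f).
by ring.
Qed.

Lemma centered_residue (m x : int) : 0 < m ->
  exists q r : int, x = q * m + r /\ - m <= 2 * r <= m.
Proof.
move=> m0; have e := divz_eq x m; have := ltz_pmod x m0; have := modz_ge0 x (lt0r_neq0 m0).
set q := (x %/ m)%Z in e *; set r := (x %% m)%Z in e *; move=> r0 rm.
case: (lerP (2 * r) m) => h; first by exists q, r; split=> //; lia.
by exists (q + 1), (r - m); split; [rewrite e; ring|lia].
Qed.

(** Lagrange's descent. The squares of the centred residues modulo [m] sum to [m * r] with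
    [0 <= r <= m], and both extreme cases would make [m] divide [p]. *)
Lemma sum4sq_descent (p : nat) (m : int) : prime p -> 1 < m < p%:Z ->
  sum4sq (m * p%:Z) -> exists2 r : int, 0 < r < m & sum4sq (r * p%:Z).
Proof.
move=> pp /andP[m1 mp] [a [b [c [d E]]]].
have m0 : 0 < m by lia.
have mNp q : p%:Z <> q * m.
  move=> e; have : (`|m| %| p)%N.
    by apply/dvdnP; exists `|q|%N; rewrite -abszM -e.
  by move/primeP: pp => [_ /[apply]]; case/orP=> /eqP; lia.
have [qa [a' [ea ha]]] := centered_residue a m0.
have [qb [b' [eb hb]]] := centered_residue b m0.
have [qc [c' [ec hc]]] := centered_residue c m0.
have [qd [d' [ed hd]]] := centered_residue d m0.
have sq_le x : - m <= 2 * x <= m -> 4 * x ^+ 2 <= m ^+ 2 by nia.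
pose r := p%:Z - (qa * (a + a') + qb * (b + b') + qc * (c + c') + qd * (d + d')).
have Er : m * r = a' ^+ 2 + b' ^+ 2 + c' ^+ 2 + d' ^+ 2.
  have -> : m * r = m * p%:Z - m * (qa * (a + a') + qb * (b + b') + qc * (c + c') + qd * (d + d')).
    by rewrite /r; ring.
  by rewrite E ea eb ec ed; ring.
have sa := sq_le _ ha; have sb := sq_le _ hb; have sc := sq_le _ hc; have sd := sq_le _ hd.
have sq0 (x : int) : 0 <= x ^+ 2 by exact: sqr_ge0.
have r_ge0 : 0 <= r by rewrite -(pmulr_rge0 _ m0) Er !addr_ge0.
have r_neq0 : r != 0.
  apply/eqP=> r0; rewrite r0 mulr0 in Er.
  have a0 : a' = 0 by apply/eqP; rewrite -sqrf_eq0; apply/eqP; have := sq0 a'; have := sq0 b'; have := sq0 c'; have := sq0 d'; lra.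
  have b0 : b' = 0 by apply/eqP; rewrite -sqrf_eq0; apply/eqP; have := sq0 a'; have := sq0 b'; have := sq0 c'; have := sq0 d'; lra.
  have c0 : c' = 0 by apply/eqP; rewrite -sqrf_eq0; apply/eqP; have := sq0 a'; have := sq0 b'; have := sq0 c'; have := sq0 d'; lra.
  have d0 : d' = 0 by apply/eqP; rewrite -sqrf_eq0; apply/eqP; have := sq0 a'; have := sq0 b'; have := sq0 c'; have := sq0 d'; lra.
  apply: (mNp (qa ^+ 2 + qb ^+ 2 + qc ^+ 2 + qd ^+ 2)); apply: (@mulfI _ m); first by rewrite gt_eqF.
  by rewrite E ea eb ec ed a0 b0 c0 d0; ring.
have r_le : r <= m by rewrite -(ler_pM2l m0) Er; lra.
(* [r = m] forces every centred residue to be [m / 2] up to sign, and then [m] divides [p]. *)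
have r_neqm : r != m.
  apply/eqP=> rm; rewrite rm in Er.
  have half x : - m <= 2 * x <= m -> 4 * x ^+ 2 = m ^+ 2 -> exists2 s : int, 2 * x = s * m & s ^+ 2 = 1.
    move=> hx e; have : (2 * x - m) * (2 * x + m) = 4 * x ^+ 2 - m ^+ 2 by ring.
    rewrite e subrr.
    by move/eqP; rewrite mulf_eq0 => /orP[]/eqP h'; [exists 1|exists (-1)]; rewrite ?expr1n ?sqrrN ?expr1n //; lra.
  have [u ua u1] : exists2 s : int, 2 * a' = s * m & s ^+ 2 = 1 by apply: half => //; lra.
  have [v vb v1] : exists2 s : int, 2 * b' = s * m & s ^+ 2 = 1 by apply: half => //; lra.
  have [w wc w1] : exists2 s : int, 2 * c' = s * m & s ^+ 2 = 1 by apply: half => //; lra.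
  have [y yd y1] : exists2 s : int, 2 * d' = s * m & s ^+ 2 = 1 by apply: half => //; lra.
  apply: (mNp (qa ^+ 2 + qa * u + qb ^+ 2 + qb * v + qc ^+ 2 + qc * w + qd ^+ 2 + qd * y + 1)).
  apply: (@mulfI _ m); first by rewrite gt_eqF.
  have -> : m * p%:Z = (qa * m) ^+ 2 + qa * m * (2 * a') + (qb * m) ^+ 2 + qb * m * (2 * b')
     + (qc * m) ^+ 2 + qc * m * (2 * c') + (qd * m) ^+ 2 + qd * m * (2 * d') + m * m.
    by rewrite E Er ea eb ec ed; ring.
  by rewrite ua vb wc yd; ring.
exists r; first by rewrite lt_def r_neq0 r_ge0 lt_def eq_sym r_neqm r_le.
(* The four terms of Euler's identity for [(a, b, c, d)] and the residues, divided by [m]. *)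
exists (qa * a' + qb * b' + qc * c' + qd * d' + r),
  (qa * b' - qb * a' + qc * d' - qd * c'),
  (qa * c' - qc * a' + qd * b' - qb * d'), (qa * d' - qd * a' + qb * c' - qc * b').
have m20 : m ^+ 2 != 0 by rewrite expf_neq0 // gt_eqF.
apply: (mulfI m20).
have -> : m ^+ 2 * (r * p%:Z) = (m * p%:Z) * (m * r) by ring.
have e1 : m * (qa * a' + qb * b' + qc * c' + qd * d' + r) = a * a' + b * b' + c * c' + d * d'.
  by rewrite mulrDr Er ea eb ec ed; ring.
have -> (x y z t : int) : m ^+ 2 * (x ^+ 2 + y ^+ 2 + z ^+ 2 + t ^+ 2)
  = (m * x) ^+ 2 + (m * y) ^+ 2 + (m * z) ^+ 2 + (m * t) ^+ 2 by ring.
by rewrite e1 E Er ea eb ec ed; ring.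
Qed.

Lemma sqr_mod_inj (p x y : nat) : prime p -> (2 * x < p)%N -> (2 * y < p)%N ->
  x ^ 2 = y ^ 2 %[mod p] -> x = y.
Proof.
move=> pp; wlog xy : x y / (x <= y)%N.
  by move=> H hx hy e; case: (leqP x y) => h; [exact: H|apply/esym/H => //; lia].
move=> hx hy /eqP; rewrite eq_sym eqn_mod_dvd ?leq_sqr // subn_sqr Euclid_dvdM //.
case/orP=> h; first by have := dvdn_leq _ h; lia.
by have := dvdn_leq _ h; lia.
Qed.

(** Pigeonhole: the [(p + 1) / 2] residues of the form [i ^ 2] and the [(p + 1) / 2] of the form
    [- 1 - j ^ 2] cannot be disjoint modulo [p]. *)
Lemma sum4sq_multiple (p : nat) : prime p -> odd p ->
  exists2 m : int, 0 < m < p%:Z & sum4sq (m * p%:Z).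
Proof.
move=> pp op; have p1 := prime_gt1 pp; have p0 : (0 < p)%N by lia.
pose h := (p./2).+1.
have hlt (i : 'I_h) : (2 * i < p)%N by have := ltn_ord i; rewrite /h; lia.
pose f (i : 'I_h) : 'I_p := Ordinal (ltn_pmod (i ^ 2) p0).
(* Adding [p ^ 2] represents [- 1 - i ^ 2] modulo [p] by a subtraction that does not truncate. *)
pose g (i : 'I_h) : 'I_p := Ordinal (ltn_pmod (p ^ 2 - (i ^ 2).+1) p0).
have glt (i : 'I_h) : ((i ^ 2).+1 <= p ^ 2)%N by have := hlt i; nia.
have finj : injective f.
  by move=> i j /(congr1 val) /= e; apply: val_inj; apply: (sqr_mod_inj pp (hlt i) (hlt j)).
have ginj : injective g.
  move=> i j /(congr1 val) /= e; apply: val_inj; apply: (sqr_mod_inj pp (hlt i) (hlt j)).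
  have h1 : ((p ^ 2 - (i ^ 2).+1) + ((i ^ 2).+1 + (j ^ 2).+1) =
             (p ^ 2 - (j ^ 2).+1) + ((i ^ 2).+1 + (j ^ 2).+1) %[mod p])%N.
    by apply/eqP; rewrite eqn_modDr; apply/eqP.
  have e1 : ((p ^ 2 - (i ^ 2).+1) + ((i ^ 2).+1 + (j ^ 2).+1) = p * p + 1 + j ^ 2)%N.
    by have := glt i; lia.
  have e2 : ((p ^ 2 - (j ^ 2).+1) + ((i ^ 2).+1 + (j ^ 2).+1) = p * p + 1 + i ^ 2)%N.
    by have := glt j; lia.
  by move: h1; rewrite e1 e2 => /eqP; rewrite eqn_modDl => /eqP.
have : ~~ [disjoint f @: setT & g @: setT].
  apply/negP=> dis.
  have := max_card (mem (f @: [set: 'I_h] :|: g @: [set: 'I_h])).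
  move: dis; rewrite -leq_card_setU => /eqP ->.
  by rewrite !card_imset // cardsT !card_ord /h; lia.
move=> /pred0Pn[_ /andP[/imsetP[i _ ->] /imsetP[j _]]] /(congr1 val) /= e.
have : (p %| i ^ 2 + j ^ 2 + 1)%N.
  have : (i ^ 2 + (j ^ 2).+1 = (p ^ 2 - (j ^ 2).+1) + (j ^ 2).+1 %[mod p])%N.
    by apply/eqP; rewrite eqn_modDr; apply/eqP.
  rewrite subnK // expnS modnMr addnS -addn1 => /eqP.
  by rewrite /dvdn.
move=> /dvdnP[m em]; exists m%:Z.
  have hi := hlt i; have hj := hlt j; rewrite !expnS !expn0 !muln1 in em.
  have i2 : (4 * (i * i) <= (p - 1) * (p - 1))%N.
    by have -> : (4 * (i * i) = (2 * i) * (2 * i))%N; [ring|apply: leq_mul; lia].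
  have j2 : (4 * (j * j) <= (p - 1) * (p - 1))%N.
    by have -> : (4 * (j * j) = (2 * j) * (2 * j))%N; [ring|apply: leq_mul; lia].
  have pp2 : ((p - 1) * (p - 1) + 2 * p = p * p + 1)%N by nia.
  clear -em i2 j2 pp2 p1.
  apply/andP; split; first by case: m em => //; lia.
  rewrite ltz_nat -(ltn_pmul2r (ltnW p1)) -em; lia.
exists (i : nat)%:Z, (j : nat)%:Z, 1, 0.
by rewrite -PoszM -em; lia.
Qed.

Theorem four_squares (n : nat) : sum4sq n%:Z.
Proof.
have prime_case p : prime p -> sum4sq p%:Z.
  move=> pp; case: (even_prime pp) => [->|op]; first by exists 1, 1, 0, 0.
  have [m hm] := sum4sq_multiple pp op.
  have [N hN] := ubnP `|m|%N; elim: N m hm hN => // N IH m hm hN sm.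
  case: (lerP m 1) => m1; first by have m1' : m = 1 by [lia]; rewrite m1' mul1r in sm.
  have [r hr sr] : exists2 r : int, 0 < r < m & sum4sq (r * p%:Z).
    by apply: sum4sq_descent => //; lia.
  by apply: (IH r) => //; lia.
elim/ltn_ind: n => n IH; case: (leqP n 1) => n1.
  by exists n%:Z, 0, 0, 0; have : n = 0%N \/ n = 1%N by [lia]; case=> ->.
rewrite -(divnK (pdiv_dvd n)) PoszM; apply: sum4sqM.
  by apply: IH; rewrite ltn_Pdiv ?prime_gt1 ?pdiv_prime //; lia.
by apply: prime_case; rewrite pdiv_prime.
Qed.

(** * Two constructions of frames *)

Definition nodd n (x : 'rV[int]_n) : nat :=
  (\sum_i odd `|x 0%R i|)%N.

(** Odd squares are 1 modulo 4 and even ones 0, so the norm of a vector bounds the Hamming weight of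
    its residue modulo 2 and fixes it modulo 4. *)
Lemma nodd_dot n (x : 'rV[int]_n) :
  exists2 t : int, 0 <= t & dot x x = (nodd x)%:Z + 4 * t.
Proof.
exists (\sum_i divz (x 0 i ^+ 2) 4).
  by apply: sumr_ge0 => i _; rewrite divz_ge0 // sqr_ge0.
rewrite dot_self /nodd (big_morph Posz PoszD (erefl 0%:Z)) mulr_sumr -big_split /=.
apply: eq_bigr => i _; set z := x 0 i.
have [q [b [-> hb]]] : exists q, exists b : bool, z = 2 * q + (b : nat)%:Z /\ odd `|z| = b.
  by exists (z %/ 2)%Z, (odd `|z|); split=> //; lia.
rewrite hb.
have -> : (2 * q + (b : nat)%:Z) ^+ 2 = (q ^+ 2 + q * (b : nat)%:Z) * 4 + (b : nat)%:Z.
  by case: b {hb} => /=; ring.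
rewrite divzMDl // divz_small ?addr0; last by case: b {hb}.
by rewrite [RHS]addrC [X in _ = X + _]mulrC.
Qed.

Lemma nodd_eq0 n (x : 'rV[int]_n) : nodd x = 0%N -> exists y, x = 2 *: y.
Proof.
move=> /eqP; rewrite /nodd sum_nat_eq0 => /forallP h.
exists (\row_i divz (x 0 i) 2); apply/rowP=> i; rewrite !mxE.
by have := h i; rewrite implyTb eqb0; set z := x 0 i; lia.
Qed.

Lemma dot_eq0 n (x : 'rV[int]_n) : dot x x = 0 -> x = 0.
Proof.
rewrite dot_self => /eqP; rewrite psumr_eq0 => [/allP h|i _]; last exact: sqr_ge0.
apply/rowP=> i; rewrite mxE; apply/eqP; rewrite -sqrf_eq0.
by apply: h; rewrite mem_index_enum.
Qed.

Lemma dot_row_mx n1 n2 (x1 y1 : 'rV[int]_n1) (x2 y2 : 'rV[int]_n2) :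
  dot (row_mx x1 x2) (row_mx y1 y2) = dot x1 y1 + dot x2 y2.
Proof. by rewrite /dot tr_row_mx mul_row_col mxE. Qed.

(** By symmetry the off-diagonal terms occur in equal pairs, which supplies the factor 2. *)
Lemma quad_form_mod m (E : 'M[int]_m) (a : 'rV[int]_m) (d : int) :
  E^T = E -> (forall i, (2 * d %| E i i)%Z) -> (forall i j, (d %| E i j)%Z) ->
  (2 * d %| dot (a *m E) a)%Z.
Proof.
move=> sE Ed Eo; rewrite dotE.
under eq_bigr => j _ do rewrite mxE big_distrl /=.
rewrite exchange_big /=.
rewrite (eq_bigr (fun i : 'I_m => \sum_(j : 'I_m | (j < i)%N) a 0 i * E i j * a 0 j + a 0 i * E i i * a 0 i
  + \sum_(j : 'I_m | (i < j)%N) a 0 i * E i j * a 0 j)); last first.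
  move=> i _; rewrite (bigID (fun j : 'I_m => (j < i)%N)) /= -addrA; congr (_ + _).
  rewrite (bigD1 i) /= ?ltnn //; congr (_ + _); apply: eq_bigl => j.
  by rewrite -leqNgt ltn_neqAle eq_sym andbC.
rewrite !big_split /= [X in _ + X](exchange_big_dep xpredT) //=.
rewrite addrAC -big_split /= rpredD //.
  apply: rpred_sum => i _; rewrite -big_split rpred_sum //= => j _.
  have -> : E j i = E i j by rewrite -[in LHS]sE mxE.
  have /dvdzP[q ->] := Eo i j; apply/dvdzP; exists (a 0 i * q * a 0 j); ring.
by apply: rpred_sum => i _; rewrite dvdz_mulr // dvdz_mull.
Qed.

Lemma dvdz_mx m n (d : int) (A : 'M[int]_(m, n)) :
  (forall i j, (d %| A i j)%Z) -> exists B, A = d *: B.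
Proof.
move=> h; exists (\matrix_(i, j) divz (A i j) d); apply/matrixP=> i j.
by rewrite !mxE mulrC divzK.
Qed.

(** The frame is [2%:M], of norm 2 for the form [dot / 2]. The code generated by [(I | R)] is
    self-dual modulo 2, so this matrix is also its parity check and the last hypothesis rules out
    codewords of weight 4. *)
Lemma extremal_binary m (R : 'M[int]_m) (i0 : 'I_m) :
  (forall i j, (2 %| (R *m R^T - 1%:M) i j)%Z) ->
  (forall i j, (2 %| (R^T *m R - 1%:M) i j)%Z) ->
  (forall i, (R *m R^T) i i = 7) ->
  (forall x (y : 'rV[int]_m), x *m (row_mx 1%:M R)^T = 2 *: y -> nodd x <> 4%N) ->
  exists C : {set 'rV['Z_(1.*2)]_(m + m)},
    typeII C /\ is_min_euclid_weight C (8 * 1).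
Proof.
move=> /dvdz_mx[E /eqP]; rewrite subr_eq addrC => /eqP RR.
move=> /dvdz_mx[E' /eqP]; rewrite subr_eq addrC => /eqP RtR RRd no4.
have {}no4 (a w : 'rV[int]_m) : nodd (row_mx a (a *m R + 2 *: w)) <> 4%N.
  apply: (no4 _ (a + a *m E + w *m R^T)).
  rewrite tr_row_mx mul_row_col tr_scalar_mx mulmx1 mulmxDl -mulmxA RR mulmxDr mulmx1.
  by rewrite -scalemxAl -scalemxAr !scalerDr [2 *: a]scaler_nat mulr2n !addrA.
have sE : E^T = E.
  have : (R *m R^T)^T = R *m R^T by rewrite trmx_mul trmxK.
  rewrite RR linearD /= tr_scalar_mx linearZ /= => /addrI.
  exact: scalemx_inj.
have Ed i : E i i = 3.
  by have := RRd i; rewrite RR !mxE eqxx /=; lia.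
pose L (x : 'rV[int]_(m + m)) := exists a w : 'rV[int]_m, x = row_mx a (a *m R + 2 *: w).
have dotL (a w a' w' : 'rV[int]_m) : dot (row_mx a (a *m R + 2 *: w)) (row_mx a' (a' *m R + 2 *: w'))
   = 2 * (dot a a' + dot (a *m E) a' + dot (a *m R) w' + dot (a' *m R) w + 2 * dot w w').
  rewrite dot_row_mx !dotDl !dotDr !dotZl !dotZr.
  rewrite [dot (a *m R) (a' *m R)]dotC dot_mulmx -mulmxA RR mulmxDr mulmx1 -scalemxAr.
  by rewrite dotDr dotZr (dotC a' a) (dotC a') [dot w (a' *m R)]dotC; ring.
have L_even x : L x -> (2 * 2 %| dot x x)%Z.
  move=> [a [w ->]]; rewrite dotL.
  (* The diagonal of [1%:M + E] is [1 + 3], hence even. *)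
  have : (2 * 1 %| dot (a *m (1%:M + E)) a)%Z.
    apply: quad_form_mod; first by rewrite linearD /= tr_scalar_mx sE.
      by move=> i; rewrite !mxE eqxx Ed.
    by move=> i j; rewrite dvd1z.
  rewrite mulmxDr mulmx1 dotDl => /dvdzP[q ->].
  by apply/dvdzP; exists (q + dot (a *m R) w + dot w w); ring.
apply: (@extremal_of_frame _ 1 2 L 2%:M) => //.
- move=> x; split=> [[a [w ->]] _ [a' [w' ->]]|Lx]; first by rewrite dotL dvdz_mulr.
  pose b := rsubmx x; pose a := lsubmx x.
  have xab : x = row_mx a b by rewrite hsubmxK.
  have key i : (2 %| ((a + b *m R^T) 0 i)%R)%Z.
    have /Lx : L (row_mx (delta_mx 0 i) (delta_mx 0 i *m R^T^T + 2 *: 0)).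
      by exists (delta_mx 0 i), 0; rewrite trmxK.
    rewrite xab dot_row_mx scaler0 addr0 dot_delta [dot b _]dotC dot_mulmx dotC trmxK.
    by rewrite dot_delta [in X in _ -> X]mxE.
  have [v hv] : exists v, a = b *m R^T + 2 *: v.
    exists (\row_i divz ((a + b *m R^T) 0 i) 2 - b *m R^T); apply/rowP=> i.
    have := key i; rewrite !mxE => /divzK; lia.
  exists a, (- (b *m E' + v *m R)); rewrite {1}xab hv; congr (row_mx _ _).
  by rewrite mulmxDl -mulmxA RtR mulmxDr mulmx1 -scalemxAl -scalemxAr scalerN scalerDr -[b + _ + _]addrA addrK.
- move=> i; exists (lsubmx (row i 2%:M)), (rsubmx (delta_mx 0 i) - lsubmx (delta_mx 0 i) *m R).
  have -> : row i 2%:M = 2 *: delta_mx 0 i :> 'rV[int]_(m + m).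
    by rewrite rowE mul_mx_scalar.
  rewrite -[LHS]hsubmxK; congr (row_mx _ _).
  by rewrite !linearZ /= scalerBr -scalemxAl addrC subrK.
- by rewrite tr_scalar_mx -scalar_mxM.
- move=> x Lx lt8; have [t t0 et] := nodd_dot x.
  have /dvdzP[q eq] := L_even _ Lx.
  have N4 : nodd x <> 4%N by case: Lx => a [w ->]; exact: no4.
  have /nodd_eq0[y ->] : nodd x = 0%N by have := dot_ge0 x; lia.
  by exists y; rewrite mul_mx_scalar.
exists (row_mx (delta_mx 0 i0) (delta_mx 0 i0 *m R + 2 *: 0)); split.
- by exists (delta_mx 0 i0), 0.
- rewrite dotL.
  have -> : dot (delta_mx 0 i0 *m E) (delta_mx 0 i0) = 3.
    by rewrite dot_delta -rowE mxE Ed.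
  have -> : dot (delta_mx 0 i0 : 'rV_m) (delta_mx 0 i0) = 1 by rewrite dot_delta mxE !eqxx.
  have z0 (x : 'rV[int]_m) : dot x 0 = 0 by rewrite dotE big1 // => i _; rewrite mxE mulr0.
  by rewrite !z0.
- move=> [u /rowP/(_ (lshift m i0))]; rewrite mul_mx_scalar row_mxEl !mxE !eqxx /= => e.
  by have : (1 : int) = 2 * u 0 (lshift m i0) by []; lia.
Qed.

(** The cross terms cancel in pairs, as in an orthogonal design; doubling both sides symmetrizes the
    double sum. *)
Lemma sum_design n m (X : 'I_m -> 'M[int]_n) (q c : 'I_m -> int) :
  (forall a b, X a *m (X b)^T + X b *m (X a)^T = (2 * q a *+ (a == b))%:M) ->
  (\sum_a c a *: X a) *m (\sum_a c a *: X a)^T = (\sum_a q a * c a ^+ 2)%:M.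
Proof.
move=> XX; apply: (@scalemx_inj _ _ _ 2) => //.
have -> : (\sum_a c a *: X a) *m (\sum_a c a *: X a)^T =
    \sum_a \sum_b (c a * c b) *: (X a *m (X b)^T).
  rewrite linear_sum mulmx_suml; apply: eq_bigr => a _.
  rewrite mulmx_sumr; apply: eq_bigr => b _.
  by rewrite linearZ /= -scalemxAl -scalemxAr scalerA.
rewrite scaler_nat mulr2n [X in _ + X]exchange_big -big_split /=.
under eq_bigr => a _.
  rewrite -big_split /= (bigD1 a) //= big1 ?addr0; last first.
    move=> b ba; rewrite [c b * _]mulrC -scalerDr XX eq_sym (negPf ba) mulr0n.
    by rewrite -[0%:M]scalemx1 scale0r scaler0.
  rewrite -scalerDr XX eqxx mulr1n scale_scalar_mx.
  over.
rewrite -raddf_sum /= scale_scalar_mx; congr (_%:M).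
by rewrite mulr_sumr; apply: eq_bigr => a _; ring.
Qed.

(** The form is [dot / 4] and the frame is twice a combination of the [X a]. [P] inverts [G] modulo
    2, the next three hypotheses are the all-one word, the minimum weight and the dual distance, and
    the rows of [X ord0] lie in the dual of the residue code. *)
Lemma extremal_of_design n r (G : 'M[int]_(r, n)) (P : 'M[int]_(n, r))
    (X : 'I_5 -> 'M[int]_n) :
  (forall i j, (4 %| (G *m G^T) i j)%Z) ->
  (forall i, (8 %| (G *m G^T) i i)%Z) ->
  (forall i j, (2 %| (G *m P - 1%:M) i j)%Z) ->
  (forall j, odd `|(const_mx 1 *m G : 'rV_n) 0 j|) ->
  (forall u, (nodd (u *m G) <= 8)%N -> nodd (u *m G) = 0%N) ->
  (forall x (y : 'rV[int]_r), x *m G^T = 2 *: y -> nodd x <> 2%N) ->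
  (forall i j, (2 %| (G *m (X ord0)^T) i j)%Z) ->
  (forall a b, X a *m (X b)^T + X b *m (X a)^T =
               (2 * (if a == ord0 then 6 else 1) *+ (a == b))%:M) ->
  (exists x (y : 'rV[int]_r) j, [/\ x *m G^T = 2 *: y, dot x x = 4 & odd `|x 0 j|]) ->
  forall k, (1 < k)%N -> exists C : {set 'rV['Z_(k.*2)]_n},
    typeII C /\ is_min_euclid_weight C (8 * k).
Proof.
move=> GG4 GG8 GP G1 Gwt Gd GX XX [x0 [y0 [j0 [x0G x0x0 x0j]]]] k k1.
have [E GGE] := dvdz_mx GG4.
have [E2 GPE] := dvdz_mx GP.
have [E3 GXE] := dvdz_mx GX.
pose L (x : 'rV[int]_n) := exists (u : 'rV[int]_r) (w : 'rV[int]_n) (v : 'rV[int]_r),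
  x = u *m G + 2 *: w /\ w *m G^T = 2 *: v.
have dotL (u : 'rV[int]_r) w (v : 'rV[int]_r) (u' : 'rV[int]_r) w' (v' : 'rV[int]_r) : w *m G^T = 2 *: v -> w' *m G^T = 2 *: v' ->
    dot (u *m G + 2 *: w) (u' *m G + 2 *: w') =
    4 * (dot (u *m E) u' + dot v u' + dot v' u + dot w w').
  move=> wv wv'; rewrite !dotDl !dotDr !dotZl !dotZr.
  have e1 : dot (u *m G) (u' *m G) = 4 * dot (u *m E) u'.
    by rewrite dotC dot_mulmx -mulmxA GGE dotC -scalemxAr dotZl.
  have e2 : dot w (u' *m G) = 2 * dot v u' by rewrite dotC dot_mulmx wv dotZr dotC.
  have e3 : dot (u *m G) w' = 2 * dot v' u by rewrite dot_mulmx wv' dotZr dotC.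
  by rewrite e1 e2 e3; ring.
have sE : E^T = E.
  have : (G *m G^T)^T = G *m G^T by rewrite trmx_mul trmxK.
  by rewrite GGE linearZ /=; apply: scalemx_inj.
have Ed i : (2 * 1 %| E i i)%Z.
  have := GG8 i; have -> : (8 : int) = 4 * (2 * 1) by [].
  by rewrite GGE mxE dvdz_mul2l.
(* A dual word is orthogonal to the all-one word, so its weight is even. *)
have dot_even w (v : 'rV[int]_r) : w *m G^T = 2 *: v -> (2 %| dot w w)%Z.
  move=> wv; pose o : 'rV[int]_n := const_mx 1 *m G.
  have -> : dot w w = dot o w + \sum_i w 0 i * (w 0 i - o 0 i).
    by rewrite !dotE -big_split /=; apply: eq_bigr => i _; ring.
  rewrite dot_mulmx wv dotZr rpredD ?dvdz_mulr // rpred_sum // => i _.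
  move: (G1 i); rewrite -/o; set g := o 0 i; set z := w 0 i => go.
  have [->|->] : z = 2 * divz z 2 \/ z = 2 * divz z 2 + 1 by lia.
    by rewrite -mulrA dvdz_mulr.
  have -> : g = 2 * divz g 2 + 1 by lia.
  by apply: dvdz_mull; apply/dvdzP; exists (divz z 2 - divz g 2); ring.
have L_even x : L x -> (2 * 4 %| dot x x)%Z.
  move=> [u [w [v [-> wv]]]]; rewrite (dotL _ _ _ _ _ _ wv wv) [2 * 4]mulrC dvdz_mul2l //.
  rewrite rpredD ?(dot_even _ _ wv) // -addrA rpredD //.
    by have := quad_form_mod u sE Ed; rewrite mulr1; apply=> i j; exact: dvd1z.
  by apply/dvdzP; exists (dot v u); ring.
(* [1 - P G] maps into the dual code: this gives the double dual. *)
have L_of_dual x : (forall y, L y -> (4 %| dot x y)%Z) -> L x.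
  move=> Lx; have [w hw] : exists w, x *m (1%:M - P *m G) = 2 *: w.
    apply: dvdz_mx => i j; rewrite ord1 -dot_delta dot_mulmx.
    set y := _ *m _; have yG : y *m G^T = 2 *: - (delta_mx 0 j *m (E2 *m G)^T).
      rewrite /y -mulmxA -trmx_mul mulmxBr mulmx1 mulmxA.
      have -> : G *m P = 1%:M + 2 *: E2 by rewrite -GPE addrC subrK.
      rewrite mulmxDl mul1mx opprD addNKr -scalemxAl linearN /= linearZ /=.
      by rewrite mulmxN -scalemxAr scalerN.
    have := Lx (2 *: y); rewrite dotZr -[4]/(2 * 2 : int) dvdz_mul2l //; apply.
    by exists 0, y, (- (delta_mx 0 j *m (E2 *m G)^T)); rewrite mul0mx add0r.
  have xE : x = x *m P *m G + 2 *: w.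
    by rewrite -hw mulmxBr mulmx1 mulmxA addrC subrK.
  have [v hv] : exists v, w *m G^T = 2 *: v.
    apply: dvdz_mx => i j; rewrite ord1.
    have : (4 %| dot x (row j G))%Z.
      by apply: Lx; exists (delta_mx 0 j), 0, 0; rewrite rowE scaler0 addr0 mul0mx scaler0.
    rewrite dotC dot_row xE mulmxDl -mulmxA GGE -scalemxAl -scalemxAr mxE rpredDl.
      by rewrite mxE -[4]/(2 * 2 : int) dvdz_mul2l.
    by rewrite mxE dvdz_mulr.
  by exists (x *m P), w, v.
have nodd_even (u w : 'rV[int]_n) : nodd (u + 2 *: w) = nodd u.
  by apply: eq_bigr => i _; rewrite !mxE; set z := u 0 i; set t := w 0 i; lia.
(* [dot x x] is 0 or 8, so the residue of [x] has weight at most 8 and vanishes. Then [x = 2 *: y]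
   with [y] dual and [dot y y] equal to 0 or 2; as [nodd y] is not 2, [y] is even and hence zero. *)
have min4 x : L x -> dot x x < 16 -> x = 0.
  move=> Lx; have [q q0 xq] := nodd_dot x; have /dvdzP[q8 x8] := L_even _ Lx.
  case: Lx xq x8 => u [w [v [-> wv]]]; rewrite nodd_even => xq x8 lt16.
  have [s us] : exists s, u *m G = 2 *: s.
    by apply/nodd_eq0/Gwt; have := dot_ge0 (u *m G + 2 *: w); lia.
  have [p uE] : exists p, u = 2 *: p.
    exists (s *m P - u *m E2); rewrite scalerBr scalemxAl -us scalemxAr -GPE mulmxBr mulmx1 mulmxA.
    by rewrite opprB addrC subrK.
  pose y := p *m G + w.
  have xy : u *m G + 2 *: w = 2 *: y by rewrite scalerDr scalemxAl -uE.
  have [v' yv] : exists v', y *m G^T = 2 *: v'.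
    exists (2 *: (p *m E) + v).
    by rewrite /y mulmxDl -mulmxA GGE wv scalerDr scalerA -scalemxAr.
  have yy : dot y y < 4 by move: lt16; rewrite xy dotZl dotZr; lia.
  have [q' q'0 yq] := nodd_dot y; have /dvdzP[t yt] := dot_even _ _ yv.
  have y2 := Gd _ _ yv.
  have [z yz] : exists z, y = 2 *: z by apply: nodd_eq0; lia.
  have z0 : z = 0.
    apply: dot_eq0; have := dot_ge0 z; move: yy; rewrite yz dotZl dotZr; lia.
  by rewrite xy yz z0 !scaler0.
(* [e] is the parity of [k]: the weighing matrix contributes 6 for odd [k], and four squares make up
   [(k - 3) / 2] or [k / 2]. *)
have [e [b1 [b2 [b3 [b4 hb]]]]] : exists (e : bool) (b1 b2 b3 b4 : int),
    [/\ 6 * (e : nat)%:Z + 4 * (b1 ^+ 2 + b2 ^+ 2 + b3 ^+ 2 + b4 ^+ 2) = 2 * k%:Z & e -> (2 < k)%N].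
  have [b1 [b2 [b3 [b4 hb]]]] := four_squares (if odd k then (k - 3)./2 else k./2).
  exists (odd k), b1, b2, b3, b4; rewrite -hb; split; last by lia.
  by case: (boolP (odd k)) => ok /=; lia.
pose c (a : 'I_5) : int := nth 0 [:: (e : nat)%:Z; 2 * b1; 2 * b2; 2 * b3; 2 * b4] a.
pose Y := \sum_a c a *: X a.
have YY : Y *m Y^T = (2 * k%:Z)%:M.
  rewrite (sum_design c XX) !big_ord_recl big_ord0 /c /=; congr (_%:M).
  by case: hb => <- _; case: (e) => /=; ring.
have [B YB] : exists B, Y = (e : nat)%:Z *: X ord0 + 2 *: B.
  exists (\sum_(a < 4) nth 0 [:: b1; b2; b3; b4] a *: X (lift ord0 a)).
  by rewrite /Y !big_ord_recl !big_ord0 /c /= !addr0 !scalerDr !scalerA.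
have [V YV] : exists V, Y *m G^T = 2 *: V.
  exists ((e : nat)%:Z *: E3^T + B *m G^T).
  have XG : X ord0 *m G^T = 2 *: E3^T by rewrite -linearZ /= -GXE trmx_mul trmxK.
  by rewrite YB mulmxDl -scalemxAl XG -scalemxAl scalerDr !scalerA mulrC.
apply: (@extremal_of_frame _ k 4 L (2 *: Y)) => //; first by lia.
- move=> x; split=> [[u [w [v [-> wv]]]] _ [u' [w' [v' [-> wv']]]]|]; last exact: L_of_dual.
  by rewrite (dotL _ _ _ _ _ _ wv wv') dvdz_mulr.
- move=> i; exists 0, (row i Y), (row i V).
  by rewrite mul0mx add0r linearZ /= -row_mul YV linearZ.
- rewrite linearZ /= -scalemxAl -scalemxAr YY scalerA scale_scalar_mx.
  by congr (_%:M); ring.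
- by move=> x Lx lt; exists 0; rewrite mul0mx; apply: min4.
exists (2 *: x0); split.
- by exists 0, x0, y0; rewrite mul0mx add0r.
- by rewrite dotZl dotZr x0x0.
move=> [u]; rewrite -scalemxAr => e2.
have x0u : x0 = u *m Y by apply: (@scalemx_inj _ _ _ 2) e2.
(* For odd [k] a nonzero vector in the span of the frame has norm at least [2k >= 6]; for even [k]
   the matrix [Y] is even, while [x0] has an odd coordinate. *)
case: (e) hb YB => -[_ ek] YB.
  have := x0x0; rewrite x0u dot_mulmx -mulmxA YY mul_mx_scalar dotZr => h.
  have k3 := ek isT; have t0 := dot_ge0 u; set t := dot u u in h t0.
  have [t1|t1] := ltrP 0 t; last by have t2 : t = 0 by [lia]; rewrite t2 mulr0 in h.
  have : 2 * k%:Z * 1 <= 2 * k%:Z * t by rewrite ler_wpM2l.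
  by lia.
move: x0j; rewrite x0u YB scale0r add0r -scalemxAr mxE; set z := (_ *m _) _ _; lia.
Qed.

(** * Decision procedures for explicit matrices *)

Definition rows_of m n (f : nat -> nat -> int) : seq (seq int) :=
  mkseq (fun i => mkseq (f i) n) m.

Definition dotl (x y : seq int) : int :=
  foldr (fun p s => p.1 * p.2 + s) 0 (zip x y).

Definition gram_all (c : nat -> nat -> int -> bool) (A B : seq (seq int)) : bool :=
  all (fun i => all (fun j => c i j (dotl (nth [::] A i) (nth [::] B j)))
    (iota 0 (size B))) (iota 0 (size A)).

Lemma dotl_mkseq n (f g : nat -> int) :
  dotl (mkseq f n) (mkseq g n) = \sum_(i < n) f i * g i.
Proof.
rewrite /dotl /mkseq zip_map foldr_map.
rewrite -[RHS](big_mkord xpredT (fun i => f i * g i)).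
by rewrite unlock /reducebig /index_iota subn0.
Qed.

Lemma mulmx_dotl m p n (f g : nat -> nat -> int) (i : 'I_m) (j : 'I_p) :
  (\matrix_(i < m, j < n) f i j *m (\matrix_(i < p, j < n) g i j)^T) i j =
  dotl (nth [::] (rows_of m n f) i) (nth [::] (rows_of p n g) j).
Proof.
rewrite !nth_mkseq // dotl_mkseq mxE; apply: eq_bigr => l _.
by rewrite !mxE.
Qed.

Lemma gram_allP c m p n (f g : nat -> nat -> int) :
  gram_all c (rows_of m n f) (rows_of p n g) ->
  forall (i : 'I_m) (j : 'I_p), c i j ((\matrix_(i < m, j < n) f i j *m (\matrix_(i < p, j < n) g i j)^T) i j).
Proof.
move=> /allP h i j; rewrite mulmx_dotl.
have /h/allP : (i : nat) \in iota 0 (size (rows_of m n f)) by rewrite size_mkseq mem_iota /=.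
by apply; rewrite size_mkseq mem_iota /=.
Qed.

Definition xorl (s t : bitseq) : bitseq := [seq p.1 (+) p.2 | p <- zip s t].

Fixpoint lincomb (m : bitseq) (rows : seq bitseq) (acc : bitseq) : bitseq :=
  match m, rows with
  | b :: m', r :: rows' => lincomb m' rows' (if b then xorl acc r else acc)
  | _, _ => acc
  end.

Fixpoint all_span (p : pred bitseq) (rows : seq bitseq) (acc : bitseq) : bool :=
  if rows is r :: rows' then all_span p rows' acc && all_span p rows' (xorl acc r)
  else p acc.

(* With [acc = 0]: no sum of exactly [t] of the rows vanishes. *)
Fixpoint no_relation (t : nat) (rows : seq bitseq) (acc : bitseq) : bool :=
  match rows, t with
  | r :: rows', t'.+1 => no_relation t rows' acc && no_relation t' rows' (xorl acc r)
  | [::], _.+1 => true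
  | _, 0 => has id acc
  end.

Lemma all_spanP p rows acc m :
  all_span p rows acc -> size m = size rows -> p (lincomb m rows acc).
Proof.
elim: rows acc m => [|r rows IH] acc [|b m] //= /andP[h1 h2] [e].
by case: b; apply: IH.
Qed.

Lemma no_relationP t rows acc m : no_relation t rows acc ->
  size m = size rows -> count id m = t -> has id (lincomb m rows acc).
Proof.
elim: rows t acc m => [|r rows IH] [|t] acc [|b m] //=.
  case: b => //= h [e] c0; suff -> : lincomb m rows acc = acc by [].
  elim: m rows c0 {e h IH} => [|[] m IHm] [|r' rows] //= c0; exact: IHm.
move=> /andP[h1 h2] [e]; case: b => /=; last by move=> c; apply: IH h1 e c.
by rewrite add1n => -[c]; apply: IH h2 e c.
Qed.

Lemma size_lincomb n m rows acc : size acc = n -> all (fun r => size r == n) rows ->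
  size (lincomb m rows acc) = n.
Proof.
elim: rows m acc => [|r rows IH] [|b m] acc //= sa /andP[/eqP sr h].
by apply: IH => //; case: b => //; rewrite size_map size_zip sa sr minnn.
Qed.

Lemma nth_lincomb n m rows acc j : size acc = n -> all (fun r => size r == n) rows ->
  size m = size rows -> (j < n)%N ->
  nth false (lincomb m rows acc) j =
  nth false acc j (+) odd (\sum_(i < size rows) nth false m i * nth false (nth [::] rows i) j)%N.
Proof.
move=> + + + jn; elim: rows m acc => [|r rows IH] [|b m] acc //= sa.
  by rewrite big_ord0 addbF.
move=> /andP[/eqP sr h] [e]; rewrite big_ord_recl /= oddD addbA IH //.
  congr (_ (+) _); case: b => /=; last by rewrite addbF.
  rewrite (nth_map (false, false)) ?size_zip ?sa ?sr ?minnn // nth_zip ?sa ?sr //=.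
  by rewrite ?mul1n ?addn0 oddb.
by case: b => //; rewrite size_map size_zip sa sr minnn.
Qed.

Definition parity (x : seq int) : bitseq := [seq odd `|z|%N | z <- x].

Definition parity_rV n (x : 'rV[int]_n) : bitseq := [seq odd `|x 0%R i|%N | i <- enum 'I_n].

Lemma size_parity_rV n (x : 'rV[int]_n) : size (parity_rV x) = n.
Proof. by rewrite size_map size_enum_ord. Qed.

Lemma nth_parity_rV n (x : 'rV[int]_n) (i : 'I_n) : nth false (parity_rV x) i = odd `|x 0%R i|%N.
Proof. by rewrite (nth_map i) ?size_enum_ord // nth_ord_enum. Qed.

Lemma count_parity_rV n (x : 'rV[int]_n) : count id (parity_rV x) = nodd x.
Proof.
rewrite /parity_rV count_map -sum1_count big_mkcond /nodd /= big_enum /=.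
by apply: eq_bigr => i _ /=; case: odd.
Qed.

Lemma parity_mulmx r n (f : nat -> nat -> int) (u : 'rV[int]_r) :
  parity_rV (u *m \matrix_(i < r, j < n) f i j) =
  lincomb (parity_rV u) (map parity (rows_of r n f)) (nseq n false).
Proof.
have srows : all (fun s => size s == n) (map parity (rows_of r n f)).
  by apply/allP=> _ /mapP[_ /mapP[i _ ->] ->]; rewrite !size_map size_iota.
have ssz : size (map parity (rows_of r n f)) = r by rewrite size_map size_mkseq.
apply: (@eq_from_nth _ false) => [|j].
  by rewrite size_parity_rV (size_lincomb _ _ srows) // size_nseq.
rewrite size_parity_rV => jn; pose jo := Ordinal jn.
rewrite (nth_lincomb _ srows) ?size_nseq ?size_parity_rV ?ssz //.
rewrite nth_nseq if_same addFb (nth_parity_rV _ jo) mxE.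
apply: (big_ind2 (fun (x : int) (y : nat) => odd `|x|%N = odd y)) => //.
  by move=> x1 x2 y1 y2 h1 h2; rewrite oddD -h1 -h2; lia.
move=> i _; rewrite nth_parity_rV (nth_map [::]) ?size_mkseq // nth_mkseq //.
by rewrite (nth_map 0) ?size_mkseq // nth_mkseq // mxE abszM !oddM !oddb.
Qed.

Lemma nodd_span r n (f : nat -> nat -> int) (p : pred nat) (u : 'rV[int]_r) :
  all_span (fun s => p (count id s)) (map parity (rows_of r n f)) (nseq n false) ->
  p (nodd (u *m \matrix_(i < r, j < n) f i j)).
Proof.
move=> h; rewrite -count_parity_rV parity_mulmx; apply: all_spanP h _.
by rewrite size_parity_rV size_map size_mkseq.
Qed.

(** The rows of [f] are the columns of a parity check matrix, and a word of weight [t] in its kernel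
    modulo 2 is a vanishing sum of [t] of them. *)
Lemma nodd_neq n r (f : nat -> nat -> int) (t : nat) (x : 'rV[int]_n) (y : 'rV[int]_r) :
  no_relation t (map parity (rows_of n r f)) (nseq r false) ->
  x *m \matrix_(i < n, j < r) f i j = 2 *: y -> nodd x <> t.
Proof.
move=> h e xt; have := @no_relationP _ _ _ (parity_rV x) h.
rewrite -parity_mulmx e count_parity_rV xt size_parity_rV size_map size_mkseq.
move=> /(_ erefl erefl)/hasP[b /mapP[i _ ->]].
by rewrite mxE abszM oddM.
Qed.

(** * The codes for k >= 2 *)

(** Pairs with [i <= j] suffice, since [A B^T + B A^T] is symmetric. *)
Definition design_check (n : nat) (q : int) (same : bool) (A B : seq (seq int)) : bool :=
  all (fun i => all (fun j =>
    dotl (nth [::] A i) (nth [::] B j) + dotl (nth [::] B i) (nth [::] A j)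
      == 2 * q *+ (same && (i == j))) (iota i (n - i))) (iota 0 n).

(* [P] selects pivot columns of [G], hence inverts it modulo 2; [t] is a word of weight 4 in the dual of
   the residue code, which provides the vector [2 t] of minimum norm. *)
Definition lattice_check (n r : nat) (G P : nat -> nat -> int) (t : nat -> int) : bool :=
  let g := rows_of r n G in
  let gT := rows_of n r (fun i j => G j i) in
  let tt := rows_of 1 n (fun _ => t) in
  [&& gram_all (fun i j z => (4 %| z)%Z && ((i == j) ==> (8 %| z)%Z)) g g,
      gram_all (fun i j z => (2 %| z - (i == j)%:Z)%Z) g (rows_of r n P),
      gram_all (fun _ _ z => odd `|z|%N) (rows_of 1 r (fun _ _ => 1)) gT,
      all_span (fun s => (8 < count id s)%N || (count id s == 0%N)) (map parity g) (nseq n false),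
      no_relation 2 (map parity gT) (nseq r false),
      gram_all (fun _ _ z => (2 %| z)%Z) tt g,
      gram_all (fun _ _ z => z == 4) tt tt
    & has (fun j => odd `|t j|%N) (iota 0 n)].

Definition frame_check (n r : nat) (G : nat -> nat -> int) (X : nat -> nat -> nat -> int) : bool :=
  let xs := mkseq (fun a => rows_of n n (X a)) 5 in
  gram_all (fun _ _ z => (2 %| z)%Z) (rows_of r n G) (nth [::] xs 0) &&
  all (fun a => all (fun b =>
    design_check n (if a == 0 then 6 else 1) (a == b) (nth [::] xs a) (nth [::] xs b))
    (iota a (5 - a))) (iota 0 5).

Lemma extremal_of_check n r G P t X :
  lattice_check n r G P t -> frame_check n r G X ->
  forall k, (1 < k)%N -> exists C : {set 'rV['Z_(k.*2)]_n},
    typeII C /\ is_min_euclid_weight C (8 * k).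
Proof.
case/and5P=> c1 c2 c3 c4 /and4P[c5 c6 c7 c8] /andP[f1 f2].
pose Gm := \matrix_(i < r, j < n) G i j.
have GmT : Gm^T = \matrix_(i < n, j < r) G j i by apply/matrixP=> i j; rewrite !mxE.
apply: (@extremal_of_design n r Gm (\matrix_(i < r, j < n) P i j)^T
   (fun a => \matrix_(i < n, j < n) X a i j)).
- by move=> i j; have /andP[] := gram_allP c1 i j.
- by move=> i; have /andP[_] := gram_allP c1 i i; rewrite eqxx.
- move=> i j; rewrite mxE [X in _ + X]mxE [X in _ - X]mxE (natz (i == j)).
  by have := gram_allP c2 i j.
- move=> j; have := gram_allP c3 ord0 j; rewrite -GmT trmxK.
  by have -> : \matrix_(_ < 1, _ < r) 1 = const_mx 1 :> 'rV[int]_r by apply/matrixP=> ? ?; rewrite !mxE.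
- move=> u le8; have := @nodd_span r n G (fun c => (8 < c)%N || (c == 0%N)) u c4.
  by rewrite ltnNge le8 /= => /eqP.
- by rewrite GmT => x y; apply: nodd_neq c5.
- by move=> i j; have := gram_allP f1 i j.
- move=> a b; wlog ab : a b / (a <= b)%N => [H|].
    case: (leqP a b) => [|/ltnW] /H // h; rewrite addrC h [b == a]eq_sym.
    by case: (a =P b) => [->|_] //; rewrite !mulr0n.
  set M := _ + _; have MT : M^T = M by rewrite linearD /= !trmx_mul !trmxK addrC.
  have Mle (i j : 'I_n) : (i <= j)%N -> M i j = 2 * (if a == ord0 then 6 else 1) *+ ((a == b) && (i == j)).
    move=> ij; rewrite mxE !mulmx_dotl.
    have bI : (b : nat) \in iota a (5 - a) by rewrite mem_iota ab subnKC ?ltn_ord // ltnW.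
    have jI : (j : nat) \in iota i (n - i) by rewrite mem_iota ij subnKC ?ltn_ord // ltnW.
    move/allP: f2 => /(_ a); rewrite mem_iota ltn_ord => /(_ isT) /allP/(_ b bI).
    move=> /allP/(_ i); rewrite mem_iota ltn_ord => /(_ isT) /allP/(_ j jI) /eqP.
    by rewrite !(nth_mkseq _ (fun a => rows_of n n (X a))).
  apply/matrixP=> i j; rewrite [RHS]mxE -mulrnA mulnb.
  case: (leqP i j) => [/Mle //|/ltnW/Mle]; rewrite -{1}MT mxE => ->.
  by rewrite [j == i]eq_sym.
pose x : 'rV[int]_n := \matrix_(_ < 1, j < n) t j.
have [j jn tj] : exists2 j, (j < n)%N & odd `|t j|%N.
  by case/hasP: c8 => j; rewrite mem_iota => /andP[_ jn] tj; exists j.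
exists x, (\row_i divz ((x *m Gm^T) 0 i) 2), (Ordinal jn); split.
- apply/rowP=> i; rewrite [RHS]mxE [in RHS]mxE mulrC divzK //.
  by have := gram_allP c6 ord0 i.
- by apply/eqP; have := gram_allP c7 ord0 ord0.
by rewrite mxE.
Qed.

(* Rows and columns are indexed by [8 c + i] with [i < 8]: the Cayley-Graves array of the octonions, in
   which [+-v] stands for [+- x_v], is filled with [q x q] blocks. *)
Definition octonion_array : seq (seq int) := 
  [:: [:: 1; -2; -3; -5; -4; -6; -7; -8];
      [:: 2; 1; 5; -3; 6; -4; -8; 7];
      [:: 3; -5; 1; 2; -7; -8; 4; 6];
      [:: 5; 3; -2; 1; -8; 7; -6; 4];
      [:: 4; -6; 7; 8; 1; 2; -3; -5];
      [:: 6; 4; 8; -7; -2; 1; 5; -3];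
      [:: 7; 8; -4; 6; 3; -5; 1; -2];
      [:: 8; -7; -6; -4; 5; 3; 2; 1]].

Definition octonion_design (S : nat -> nat -> nat -> int) (i j : nat) : int :=
  let v := nth 0 (nth [::] octonion_array (i %% 8)) (j %% 8) in
  sgz v * S `|v|%N.-1 (i %/ 8)%N (j %/ 8)%N.

(* [x_1, ..., x_4] carry the weighing matrix of weight 6, which is made of a part on the first two
   blocks and a part on the others; [x_5, ..., x_8] remain free. *)
Definition weighing_block (off : seq int) (v c d : nat) : int :=
  if (c < 2)%N == (d < 2)%N then
    if c == d then nth 0 [:: -1; 0; 0; 1] v
    else if (v < 4)%N then (if (c < 2)%N then 1 else nth 0 off v) else 0
  else 0.

(** Index 0 is the weighing matrix; index [b + 1] replaces [x_(b+5)] by the identity block and the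
    other variables by 0, which leaves a signed permutation matrix. *)
Definition design_family (off : seq int) (a : nat) : nat -> nat -> int :=
  octonion_design (if a is b.+1 then fun v c d => ((v == b + 4) && (c == d))%N%:Z
                   else weighing_block off).

(* The entries 2 lift the binary generators so that the Gram matrix vanishes modulo 4 and its diagonal
   modulo 8; the codes were found by random search in the kernel of [weighing_block] modulo 2. *)
Definition G32 : seq (seq int) := 
  [:: [:: 0; 0; 1; 1; 1; 1; 0; 0; 1; 1; 0; 0; 1; 1; 0; 0; 0; 1; 1; 0; 0; 1; 1; 0; 0; 0; 0; 0; 0; 0; 0; 2];
      [:: 1; 1; 0; 0; 1; 1; 0; 0; 0; 1; 0; 1; 1; 0; 1; 0; 1; 0; 0; 1; 1; 0; 0; 1; 0; 0; 0; 0; 0; 0; 0; 2];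
      [:: 0; 1; 1; 0; 1; 1; 1; 1; 0; 0; 0; 0; 1; 0; 0; 1; 0; 1; 1; 0; 0; 0; 2; 0; 0; 1; 1; 0; 0; 0; 0; 0];
      [:: 0; 0; 1; 1; 0; 0; 1; 1; 1; 0; 1; 0; 0; 1; 0; 1; 1; 0; 0; 1; 0; 0; 0; 2; 1; 0; 0; 1; 0; 0; 0; 0];
      [:: 0; 0; 1; 0; 0; 1; 0; 0; 0; 1; 0; 0; 1; 0; 1; 1; 1; 1; 1; 0; 1; 0; 2; 2; 1; 0; 2; 0; 1; 0; 0; 0];
      [:: 1; 0; 1; 1; 1; 1; 0; 1; 1; 1; 0; 1; 0; 0; 1; 0; 1; 1; 0; 1; 0; 1; 0; 0; 0; 1; 2; 2; 2; 1; 0; 2];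
      [:: 0; 0; 1; 0; 0; 0; 1; 0; 1; 0; 1; 1; 0; 0; 1; 0; 1; 0; 1; 1; 0; 1; 0; 0; 0; 1; 0; 2; 0; 0; 1; 0];
      [:: 1; 1; 1; 0; 1; 0; 0; 0; 1; 1; 1; 0; 1; 1; 1; 0; 0; 1; 1; 1; 1; 0; 2; 2; 1; 0; 2; 2; 0; 2; 2; 1]].

Definition G40 : seq (seq int) := 
  [:: [:: 0; 1; 1; 0; 1; 1; 1; 1; 0; 1; 1; 0; 1; 1; 1; 1; 0; 0; 0; 1; 0; 1; 0; 0; 0; 0; 0; 1; 0; 1; 0; 0; 0; 0; 0; 0; 0; 0; 0; 0];
      [:: 1; 0; 0; 1; 1; 0; 0; 1; 0; 0; 0; 0; 0; 0; 0; 0; 0; 1; 1; 1; 1; 1; 0; 1; 1; 0; 0; 0; 0; 0; 1; 0; 0; 0; 0; 0; 0; 0; 0; 2];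
      [:: 1; 1; 1; 1; 0; 1; 1; 0; 1; 0; 0; 1; 0; 0; 0; 0; 1; 1; 0; 0; 0; 0; 1; 1; 0; 1; 1; 0; 1; 0; 0; 1; 0; 0; 0; 0; 0; 0; 0; 0];
      [:: 1; 1; 1; 0; 1; 0; 0; 0; 0; 0; 0; 1; 0; 0; 0; 1; 1; 0; 0; 0; 1; 0; 0; 0; 1; 0; 1; 0; 0; 0; 0; 2; 1; 0; 1; 0; 0; 0; 0; 0];
      [:: 0; 1; 1; 1; 0; 1; 1; 1; 1; 1; 1; 0; 1; 0; 0; 0; 1; 1; 1; 0; 1; 1; 1; 0; 0; 1; 0; 1; 0; 2; 2; 2; 0; 1; 0; 1; 0; 0; 0; 0];
      [:: 0; 1; 0; 0; 1; 0; 1; 1; 1; 0; 1; 1; 1; 1; 0; 1; 1; 0; 0; 0; 1; 0; 0; 0; 1; 0; 0; 0; 1; 0; 0; 2; 1; 0; 0; 0; 1; 0; 0; 2];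
      [:: 1; 1; 0; 1; 0; 0; 1; 0; 1; 1; 0; 1; 1; 0; 1; 1; 0; 1; 1; 1; 1; 0; 0; 0; 0; 1; 1; 1; 1; 0; 2; 2; 0; 1; 2; 0; 0; 1; 0; 0];
      [:: 0; 0; 1; 1; 1; 0; 1; 0; 1; 1; 0; 0; 1; 0; 1; 0; 1; 0; 0; 0; 0; 0; 1; 0; 0; 0; 0; 0; 0; 2; 2; 2; 1; 0; 0; 0; 2; 2; 1; 0];
      [:: 1; 1; 0; 0; 0; 0; 1; 1; 0; 1; 0; 1; 0; 1; 0; 1; 0; 1; 0; 0; 0; 0; 0; 1; 0; 0; 0; 0; 0; 2; 2; 2; 0; 1; 0; 2; 0; 0; 2; 1]].

Definition entry (l : seq (seq int)) (i j : nat) : int := nth 0 (nth [::] l i) j.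

Definition pivot_rows (s : seq nat) (i j : nat) : int := (nth 0 s i == j)%N%:Z.

Lemma lattice_check32 : lattice_check 32 8 (entry G32)
  (pivot_rows [:: 22; 23; 26; 27; 28; 29; 30; 31]) (fun j => (j \in [:: 0; 1; 7; 27]%N)%:Z).
Proof. by vm_compute. Qed.

Lemma frame_check32 : frame_check 32 8 (entry G32) (design_family [:: 1; 1; 1; 1]).
Proof. by vm_compute. Qed.

Lemma lattice_check40 : lattice_check 40 9 (entry G40)
  (pivot_rows [:: 29; 30; 31; 34; 35; 36; 37; 38; 39]) (fun j => (j \in [:: 0; 1; 7; 39]%N)%:Z).
Proof. by vm_compute. Qed.

(** The second part now has three blocks, so a row meets two off-diagonal ones: two variables in
    each give [2 + 2 * 2 = 6], against [2 + 4] for length 32. *)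
Lemma frame_check40 : frame_check 40 9 (entry G40) (design_family [:: 1; 0; 1; 0]).
Proof. by vm_compute. Qed.

(** * The binary codes and the theorem *)

Definition binary_check (m : nat) (R : nat -> nat -> int) : bool :=
  let r := rows_of m m R in
  let rT := rows_of m m (fun i j => R j i) in
  let hT := rows_of (m + m) m (fun i j => if (i < m)%N then (i == j)%:Z else R j (i - m)%N) in
  [&& gram_all (fun i j z => (2 %| z - (i == j)%:Z)%Z && ((i == j) ==> (z == 7))) r r,
      gram_all (fun i j z => (2 %| z - (i == j)%:Z)%Z) rT rT
    & no_relation 4 (map parity hT) (nseq m false)].

Lemma extremal_of_binary_check m R : binary_check m.+1 R ->
  exists C : {set 'rV['Z_(1.*2)]_(m.+1 + m.+1)}, typeII C /\ is_min_euclid_weight C (8 * 1).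
Proof.
case/and3P=> c1 c2 c3; pose Rm := \matrix_(i < m.+1, j < m.+1) R i j.
have RmT : Rm^T = \matrix_(i < m.+1, j < m.+1) R j i by apply/matrixP=> i j; rewrite !mxE.
apply: (@extremal_binary m.+1 Rm ord0).
- move=> i j; rewrite mxE [X in _ + X]mxE [X in _ - X]mxE (natz (i == j)).
  by have /andP[] := gram_allP c1 i j.
- move=> i j; rewrite mxE [X in _ + X]mxE [X in _ - X]mxE (natz (i == j)).
  by have := gram_allP c2 i j; rewrite -[X in _ *m X^T]RmT trmxK -RmT.
- by move=> i; have /andP[_] := gram_allP c1 i i; rewrite eqxx => /eqP.
move=> x y; rewrite tr_row_mx tr_scalar_mx.
have -> : col_mx 1%:M Rm^T = \matrix_(i < m.+1 + m.+1, j < m.+1)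
    (if (i < m.+1)%N then (i == j :> nat)%:Z else R j (i - m.+1)%N).
  apply/matrixP=> i j; rewrite -[i]splitK; case: split => l /=.
    by rewrite col_mxEu !mxE /= ltn_ord natz.
  by rewrite col_mxEd !mxE /= ltnNge leq_addr addKn.
exact: nodd_neq c3.
Qed.

Definition circulant (m : nat) (s : seq nat) (i j : nat) : int :=
  (((j + m - i) %% m)%N \in s)%:Z.

Theorem theorem4p3 (k : nat) : (0 < k)%N ->
  (exists C : {set 'rV['Z_(k.*2)]_32}, extremal_typeII C) /\
  (exists C : {set 'rV['Z_(k.*2)]_40}, extremal_typeII C).
Proof.
move=> k0; rewrite /extremal_typeII.
have -> : (4 * k * (32 %/ 24) + 4 * k = 8 * k)%N by rewrite (_ : 32 %/ 24 = 1)%N //; lia.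
case: (ltnP 1 k) => [k1|k1].
  split; first exact: extremal_of_check lattice_check32 frame_check32 k k1.
  exact: extremal_of_check lattice_check40 frame_check40 k k1.
have {k0 k1} -> : k = 1%N by lia.
split.
  (* The list is the support of the first row of [R]; its 7 elements give [(I | R)] rows of weight
     8. *)
  apply: (@extremal_of_binary_check 15 (circulant 16 [:: 0; 1; 2; 3; 4; 6; 9]%N)).
  by vm_compute.
apply: (@extremal_of_binary_check 19 (circulant 20 [:: 0; 1; 2; 3; 7; 8; 11]%N)).
by vm_compute.
Qed.
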